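(* Let $k\ge 3$ and let $G$ be an $r$-regular (simple) graph with $n$ vertices and $m$ edges, with adjacency eigenvalues $\lambda_1,\dots,\lambda_n$. Then the adjacency spectrum of the subdivision hypergraph $S(G^{k})$ consists of: (i) the eigenvalue $-\frac{k-2}{k-1}$ with multiplicity $m(k-3)$; (ii) the two roots of $(k-1)x^{2}-(k-2)(k-3)x-(k-1)(k-2)=0$, each with multiplicity $m-n$; (iii) for each $i=1,\dots,n$, the three roots of $(k-1)^{2}x^{3}-(k-1)(k-2)(\lambda_i+k-3)x^{2}-\{(k-1)^{2}(r+\lambda_i)+(k-1)^{2}(k-2)+(k-2)^{3}(r+\lambda_i)-(k-2)^{2}(k-3)\lambda_i\}x+(k-1)(k-2)(k-3)(r+\lambda_i)+(k-1)(k-2)^{2}\lambda_i-2(k-1)(k-2)^{2}(r+\lambda_i)=0.$ Precisely: writing $q(x)=x^{2}-\frac{(k-2)(k-3)}{k-1}x-(k-2)$ and $c_i(x)$ for the cubic in (iii) divided by $(k-1)^2$, one has, as rational functions, $\det(xI-A_{S(G^k)})=\big(x+\frac{k-2}{k-1}\big)^{m(k-3)}q(x)^{m-n}\prod_{i=1}^n c_i(x)$.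
   Context: A hypergraph $H=(V,E)$ consists of a finite vertex set and hyperedges that are subsets of $V$ of size at least $2$. For a $k$-uniform hypergraph (all hyperedges of size $k$) with vertices $v_1,\dots,v_N$, the adjacency matrix $A_H$ has $(A_H)_{ij}=\frac{d_{ij}}{k-1}$ for $i\ne j$, where $d_{ij}$ is the number of hyperedges containing both $v_i,v_j$, and $0$ on the diagonal; the adjacency spectrum is the multiset of its eigenvalues. For a graph $G$ this is the usual adjacency matrix. The $k$-th power $G^{k}$ ($k\ge3$) of a graph $G=(V,E)$ is the $k$-uniform hypergraph whose vertex set is $V$ together with $k-2$ new distinct vertices $i_{e,1},\dots,i_{e,k-2}$ for each edge $e\in E$, and whose hyperedges are $e\cup\{i_{e,1},\dots,i_{e,k-2}\}$ for $e\in E$. Subdivision of a hyperedge $e$ of cardinality $k$: add a new vertex $p_e$, delete $e$, and add the $k$ hyperedges $\{p_e\}\cup(e\setminus\{v\})$, $v\in e$. The subdivision hypergraph $S(H)$ is obtained by subdividing every hyperedge of $H$. *)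

(* Defs.v *)
From HB Require Import structures.
From mathcomp Require Import all_boot all_order all_algebra.

Set Implicit Arguments.
Unset Strict Implicit.
Unset Printing Implicit Defensive.

Import Order.TTheory GRing.Theory Num.Theory.
Local Open Scope ring_scope.

(* The embedding of {poly R} into the field of rational functions. *)
Notation "p %:F" := (@FracField.tofrac _ p) : ring_scope.

(* Simple graphs are the 2-uniform hypergraphs. *)
Record hypergraph := Hypergraph {
  vertex : finType;
  hedges : {set {set vertex}};
  hedges_ge2 : forall e, e \in hedges -> (2 <= #|e|)%N
}.

Definition uniform (k : nat) (H : hypergraph) : Prop :=
  forall e, e \in hedges H -> #|e| = k.

Definition hdegree (H : hypergraph) (v : vertex H) : nat :=
  #|[set e in hedges H | v \in e]|.

Definition regular (r : nat) (H : hypergraph) : Prop :=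
  forall v : vertex H, hdegree v = r.

Definition codegree (H : hypergraph) (u v : vertex H) : nat :=
  #|[set e in hedges H | (u \in e) && (v \in e)]|.

(* Meaningful for k-uniform H; for k = 2 the off-diagonal entries are 0 or 1. *)
Definition adjmx (R : fieldType) (k : nat) (H : hypergraph) :
    'M[R]_#|vertex H| :=
  \matrix_(i, j)
    if i == j then 0
    else (codegree (enum_val i) (enum_val j))%:R / (k%:R - 1).

(* s lists the eigenvalues of A with their algebraic multiplicities. *)
Definition is_spectrum (R : fieldType) (N : nat) (A : 'M[R]_N) (s : seq R) :
    Prop :=
  char_poly A = \prod_(x <- s) ('X - x%:P).

Section Power.

Variables (k : nat) (G : hypergraph).

Definition edge_of : finType := {e : {set vertex G} | e \in hedges G}.

Definition power_vertex : finType := (vertex G + edge_of * 'I_(k - 2))%type.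

Definition power_edge (e : edge_of) : {set power_vertex} :=
  [set inl v | v in val e] :|: [set inr (e, j) | j : 'I_(k - 2)].

Definition power_hedges : {set {set power_vertex}} :=
  [set power_edge e | e : edge_of].

Lemma card_power_edge (e : edge_of) : #|power_edge e| = (#|val e| + (k - 2))%N.
Proof.
rewrite /power_edge cardsU.
rewrite (_ : _ :&: _ = set0) ?cards0 ?subn0; last first.
  apply/setP=> x; rewrite !inE; apply/negP=> /andP[/imsetP[v _ ->]].
  by case/imsetP.
rewrite card_imset; last by move=> ? ? [].
by rewrite card_imset ?cardsT ?card_ord // => ? ? [].
Qed.

Lemma power_ge2 e : e \in power_hedges -> (2 <= #|e|)%N.
Proof.
case/imsetP=> f _ ->; rewrite card_power_edge.
exact: leq_trans (hedges_ge2 (valP f)) (leq_addr _ _).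
Qed.

(* The k-th power of a graph G, for 2 <= k. *)
Definition graph_power : hypergraph := Hypergraph power_ge2.

Lemma graph_power_uniform : (2 <= k)%N -> uniform 2 G -> uniform k graph_power.
Proof.
by move=> k2 G2 e /imsetP[f _ ->]; rewrite card_power_edge (G2 _ (valP f)) subnKC.
Qed.

End Power.

Section Subdivision.

Variable H : hypergraph.

(* The vertex inr e is p_e. *)
Definition subdiv_vertex : finType := (vertex H + edge_of H)%type.

Definition subdiv_edge (e : edge_of H) (v : vertex H) : {set subdiv_vertex} :=
  inr e |: [set inl u | u in val e :\ v].

Definition subdiv_hedges : {set {set subdiv_vertex}} :=
  [set subdiv_edge e v | e in [set: edge_of H], v in val e].

Lemma card_subdiv_edge (e : edge_of H) v :
  v \in val e -> #|subdiv_edge e v| = #|val e|.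
Proof.
move=> ve; rewrite cardsU1 (cardsD1 v (val e)) ve card_imset; last by move=> ? ? [].
by congr (_ + _)%N; case: imsetP => // -[].
Qed.

Lemma subdiv_ge2 e : e \in subdiv_hedges -> (2 <= #|e|)%N.
Proof.
case/imset2P=> f v _ vf ->; rewrite card_subdiv_edge //.
exact: hedges_ge2 (valP f).
Qed.

Definition subdivision : hypergraph := Hypergraph subdiv_ge2.

Lemma subdivision_uniform k : uniform k H -> uniform k subdivision.
Proof.
move=> Hk e /imset2P[f v _ vf ->].
by rewrite card_subdiv_edge // (Hk _ (valP f)).
Qed.

End Subdivision.

Definition quad_poly (R : fieldType) (k : nat) : {poly R} :=
  let K := k%:R in
  (K - 1) *: 'X^2 - ((K - 2) * (K - 3)) *: 'X - ((K - 1) * (K - 2))%:P.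

Definition cubic_poly (R : fieldType) (k r : nat) (l : R) : {poly R} :=
  let K := k%:R in
  let t := r%:R + l in
  ((K - 1) ^+ 2) *: 'X^3
  - ((K - 1) * (K - 2) * (l + K - 3)) *: 'X^2
  - ((K - 1) ^+ 2 * t + (K - 1) ^+ 2 * (K - 2) + (K - 2) ^+ 3 * t
     - (K - 2) ^+ 2 * (K - 3) * l) *: 'X
  + ((K - 1) * (K - 2) * (K - 3) * t + (K - 1) * (K - 2) ^+ 2 * l
     - 2 * (K - 1) * (K - 2) ^+ 2 * t)%:P.

(* Main.v *)
Require Import Defs.
From HB Require Import structures.
From mathcomp Require Import all_boot all_order all_algebra.
From mathcomp Require Import perm ring zify.
Import Order.TTheory GRing.Theory Num.Theory.
Local Open Scope ring_scope.

Set Implicit Arguments.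
Unset Strict Implicit.
Unset Printing Implicit Defensive.

(* Order the vertices of S(G^k) as: vertices of G, points p_e, extra vertices
   (e, j).  With a = (k-2)/(k-1), B the incidence matrix of G and U the
   indicator matrix of "(e, j) lies over e", the adjacency matrix is
     [aA, B, aBU; B^T, 0, U; a(BU)^T, U^T, a(U^T U - I)],
   where B B^T = A + rI and U U^T = (k-2)I.  Hence two successive Schur
   complements, eliminating first the (e, j) and then the p_e, only involve
   scalar matrices, and leave det (u I - v A) with u, v rational functions; this
   factors over the eigenvalues of A. *)

(** * Block determinants *)

(** [X] stands for the inverse of [D] times [C]. Supplying it as a solution of a linear equation
    avoids inverting [D], and the block matrix then factors into an upper triangular and a lower
    unitriangular one. *)
Lemma det_schur (R : comNzRingType) n1 n2 (A : 'M[R]_n1) (B : 'M_(n1, n2))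
    (C : 'M_(n2, n1)) (D : 'M_n2) (X : 'M_(n2, n1)) :
  D *m X = C -> \det (block_mx A B C D) = \det (A - B *m X) * \det D.
Proof.
move=> DX.
have -> : block_mx A B C D
    = block_mx (A - B *m X) B 0 D *m block_mx 1%:M 0 X 1%:M.
  by rewrite mulmx_block !mulmx1 !mulmx0 !add0r subrK DX.
by rewrite det_mulmx det_ublock det_lblock !det1 !mulr1.
Qed.

(** The factor [y ^+ m] on the left replaces the exponent [n - m] that the kernel of [U] would carry
    on the right. *)
Lemma det_scalar_sub_gram (F : fieldType) m n (U : 'M[F]_(m, n)) (y b p : F) :
  y != 0 -> U *m U^T = p%:M ->
  \det (y%:M - b *: (U^T *m U)) * y ^+ m = y ^+ n * (y - b * p) ^+ m.
Proof.
move=> y0 UU.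
(* Sylvester: both sides expand the same determinant by a Schur complement. *)
pose M := block_mx y%:M (b *: U^T) U 1%:M.
have -> : \det (y%:M - b *: (U^T *m U)) = \det M.
  by rewrite (@det_schur _ _ _ _ _ _ _ U) ?mul1mx // det1 mulr1 scalemxAl.
have -> : M = (block_mx y%:M U^T (b *: U) 1%:M)^T *m 1%:M.
  by rewrite mulmx1 tr_block_mx !tr_scalar_mx linearZ /= trmxK.
rewrite mulmx1 det_tr.
(* The right factor has determinant [y ^+ m] and is chosen to clear the upper right block. *)
have E : block_mx y%:M U^T (b *: U) 1%:M *m block_mx 1%:M (- U^T) 0 y%:M
     = block_mx y%:M 0 (b *: U) ((y - b * p)%:M).
  rewrite mulmx_block !mulmx1 !mulmx0 !addr0 !mul_scalar_mx mul_mx_scalar.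
  rewrite scalerN addNr mulmxN -scalemxAl UU scale1r scale_scalar_mx addrC.
  by rewrite raddfB.
have := congr1 determinant E.
by rewrite det_mulmx det_ublock det_lblock !det_scalar expr1n mul1r.
Qed.

Lemma char_poly_horner (F : comNzRingType) n (A : 'M[F]_n) (z : F) :
  (char_poly A).[z] = \det (z%:M - A).
Proof.
rewrite -horner_evalE -det_map_mx; congr (\det _); apply/matrixP=> i j.
by rewrite !mxE rmorphB rmorphMn /= /horner_eval hornerX hornerC.
Qed.

(** For nonzero [v] the determinant is [v ^+ n] times the characteristic polynomial at [u / v];
    [v = 0] is treated apart. The morphism [f] lets [u] and [v] be rational functions while the
    eigenvalues stay in [R]. *)
Lemma det_pencil (R F : fieldType) (f : {rmorphism R -> F}) n (A : 'M[R]_n)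
    (l : n.-tuple R) (u v : F) :
  is_spectrum A l ->
  \det (u%:M - v *: map_mx f A) = \prod_(i < n) (u - v * f (tnth l i)).
Proof.
move=> Al; have [->|v0] := eqVneq v 0.
  rewrite scale0r subr0 det_scalar.
  under eq_bigr do rewrite mul0r subr0.
  by rewrite prodr_const card_ord.
have -> : u%:M - v *: map_mx f A = v *: ((u / v)%:M - map_mx f A).
  by rewrite scalerBr scale_scalar_mx mulrC divfK.
rewrite detZ -char_poly_horner -map_char_poly Al rmorph_prod horner_prod.
rewrite big_tuple -[n in v ^+ n]card_ord -prodr_const -big_split /=.
apply: eq_bigr => i _.
by rewrite map_polyXsubC hornerXsubC mulrBr mulrC divfK.
Qed.

Section BlockDeterminant.

Variables (F : fieldType) (n m N : nat).
Variables (A : 'M[F]_n) (B : 'M[F]_(n, m)) (U : 'M[F]_(m, N)).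
Variables (x a p r : F).
Hypotheses (BB : B *m B^T = A + r%:M) (UU : U *m U^T = p%:M).

(** The lower right block of the characteristic matrix is [y - a U^T U]: it acts as [y] on the
    kernel of [U] and as [w = y - a p] on the image of [U^T]. Once it is eliminated, the points p_e
    carry the scalar block [q / w]. *)
Let y := x + a.
Let w := x - a * (p - 1).
Let q := x * w - p.

Hypotheses (y0 : y != 0) (w0 : w != 0) (q0 : q != 0).

Definition power_subdivision_mx : 'M[F]_(n + m + N) :=
  block_mx (block_mx (a *: A) B B^T 0) (col_mx (a *: (B *m U)) U)
           (row_mx (a *: (B *m U)^T) U^T) (a *: (U^T *m U) - a%:M).

Lemma det_power_subdivision_mx :
  \det (x%:M - power_subdivision_mx) * y ^+ m =
  y ^+ N * q ^+ m *
  \det ((x - r * (a ^+ 2 * p * q + y ^+ 2) / (w * q))%:M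
        - (a + (a ^+ 2 * p * q + y ^+ 2) / (w * q)) *: A).
Proof.
have yE : y = w + a * p by rewrite /w /y; ring.
have wE : w = y - a * p by rewrite /w /y; ring.
rewrite /power_subdivision_mx 2!scalar_mx_block !opp_block_mx !add_block_mx.
rewrite !add0r subr0.
have -> : (x%:M - (a *: (U^T *m U) - a%:M) : 'M_N) = y%:M - a *: (U^T *m U).
  by rewrite opprB addrA -raddfD.
(* The columns of the lower left block lie in the image of [U^T], where the lower right block acts
   as [w]; dividing by [w] therefore solves the equation of [det_schur]. *)
pose X := row_mx (- (a / w) *: (B *m U)^T) (- w^-1 *: U^T).
have DU : (y%:M - a *: (U^T *m U)) *m U^T = w *: U^T.
  rewrite mulmxBl mul_scalar_mx -scalemxAl -mulmxA UU mul_mx_scalar scalerA.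
  by rewrite -scalerBl -wE.
rewrite (@det_schur _ _ _ _ _ _ _ X); last first.
  rewrite mul_mx_row opp_row_mx -!scalemxAr trmx_mul mulmxA DU -!scalemxAl.
  by rewrite !scalerA !mulNr mulVf // divfK // !scaleNr scale1r.
rewrite -[LHS]mulrA (det_scalar_sub_gram _ y0 UU) -wE.
rewrite opp_col_mx mul_col_row opp_block_mx add_block_mx.
have BUU : B *m U *m U^T = p *: B by rewrite -mulmxA UU mul_mx_scalar.
rewrite !mulNmx -!scalemxAl -!scalemxAr trmx_mul !mulmxA BUU UU.
rewrite mul_scalar_mx -!scalemxAl BB !scaleNr !scalerN !opprK !scale_scalar_mx.
have -> : x%:M - (w^-1 * p)%:M = (q / w)%:M :> 'M_m.
  by rewrite -raddfB; congr (_%:M); rewrite /q; field.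
(* The first elimination has turned the block [- B^T] into [-(1 + a p / w) B^T = -(y / w) B^T],
   which is then divided by [q / w]. *)
pose Y := - (y / q) *: B^T.
rewrite (@det_schur _ _ _ _ _ _ _ Y); last first.
  rewrite mul_scalar_mx scalerA -[- B^T]scaleN1r scalerA -scalerBl.
  by congr (_ *: _); rewrite yE; field; rewrite w0 q0.
rewrite det_scalar exprMn exprVn.
(* [B B^T] has collected [a^2 p / w] from the first complement and [y^2 / (w q)] from the second;
   their sum is the fraction in the statement. *)
set L := \det _; set L' := \det _.
have -> : L = L'.
  rewrite /L /L' /Y; congr (\det _).
  rewrite -[- B]scaleN1r !scalerA -scalerBl -scalemxAr -scalemxAl BB.
  apply/matrixP=> i j; rewrite !mxE.
  by rewrite yE; case: (i == j); rewrite ?mulr1n ?mulr0n; field;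
     rewrite w0 q0.
by field; rewrite expf_neq0.
Qed.

End BlockDeterminant.

(** * Codegrees in subdivisions and powers *)

Lemma codegreeC (H : hypergraph) (u v : vertex H) : codegree u v = codegree v u.
Proof. by apply: eq_card => e; rewrite !inE andbCA andbC -andbA andbC -andbA. Qed.

Lemma hdegreeE (H : hypergraph) (v : vertex H) : hdegree v = codegree v v.
Proof. by apply: eq_card => e; rewrite !inE andbb. Qed.

Lemma codegree_sum (H : hypergraph) (u v : vertex H) :
  codegree u v = (\sum_(e : edge_of H) ((u \in val e) && (v \in val e)))%N.
Proof.
rewrite -big_mkcond /= sum1dep_card -(card_imset _ val_inj).
apply: eq_card => e; apply/idP/imsetP => [|[f]]; rewrite !inE.
  by case/andP=> eH uve; exists (Sub e eH) => //; rewrite inE.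
by move=> uvf ->; rewrite (valP f).
Qed.

Section SubdivisionCodegree.

Variable H : hypergraph.
Implicit Types (e f : edge_of H) (u v w : vertex H).

Lemma inl_subdiv_edge e w u :
  (inl u \in subdiv_edge e w) = (u != w) && (u \in val e).
Proof.
rewrite !inE /=; apply/imsetP/idP => [[v]|uw]; last by exists u; rewrite ?inE.
by rewrite !inE => vw [->].
Qed.

Lemma inr_subdiv_edge e w f : (inr f \in subdiv_edge e w) = (f == e).
Proof. by rewrite !inE; apply/orb_idr => /imsetP[]. Qed.

(** The new point of a subdivided hyperedge reveals [e], and the one vertex of [e] that is missing
    reveals [v]. *)
Lemma subdiv_edge_inj e f v w : v \in val e -> w \in val f ->
  subdiv_edge e v = subdiv_edge f w -> e = f /\ v = w.
Proof.
move=> ve wf E.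
have /eqP ef : e == f by rewrite -(inr_subdiv_edge f w) -E inr_subdiv_edge.
split=> //; apply/eqP; rewrite -ef in wf E; apply/idPn => vw.
by have := inl_subdiv_edge e v v; rewrite E inl_subdiv_edge vw ve eqxx.
Qed.

(** By [subdiv_edge_inj], hyperedges of the subdivision can be counted as pairs of an old hyperedge
    and the vertex removed from it. *)
Lemma codegree_subdivision (x y : vertex (subdivision H)) :
  codegree x y =
  (\sum_(e : edge_of H)
     #|[set w in val e | (x \in subdiv_edge e w) && (y \in subdiv_edge e w)]|)%N.
Proof.
pose P (p : edge_of H * vertex H) := [&& p.2 \in val p.1,
  x \in subdiv_edge p.1 p.2 & y \in subdiv_edge p.1 p.2].
transitivity #|[set p | P p]|.
  rewrite -(@card_in_imset _ _ (fun p => subdiv_edge p.1 p.2)).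
    apply: eq_card => e; apply/idP/imsetP => [|[[f w]]]; rewrite !inE.
      case/andP=> /imset2P[f w _ wf ->] xy.
      by exists (f, w) => //; rewrite inE /P wf.
    case/and3P=> /= wf xf yf ->; rewrite xf yf !andbT.
    by apply/imset2P; exists f w; rewrite ?inE.
  move=> [e v] [f w]; rewrite !inE => /andP[/= ve _] /andP[/= wf _].
  by move=> /(subdiv_edge_inj ve wf)[-> ->].
rewrite -sum1_card; under eq_bigl do rewrite inE.
rewrite -(pair_big_dep predT (fun e w => P (e, w)) (fun _ _ => 1%N)) /=.
by apply: eq_bigr => e _; rewrite -sum1_card; apply: eq_bigl => w; rewrite inE.
Qed.

Variable k : nat.
Hypothesis Hk : uniform k H.

(** In each old hyperedge through both vertices, the removed vertex may be any of the other
    [k - 2]. *)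
Lemma codegree_subdivision_ll u v : u != v ->
  codegree (inl u : vertex (subdivision H)) (inl v) = (codegree u v * (k - 2))%N.
Proof.
move=> uv; rewrite codegree_subdivision codegree_sum big_distrl /=.
apply: eq_bigr => e _; have [/andP[ue ve]|uve] := boolP (_ && _).
  rewrite mul1n -(Hk (valP e)) (cardsD1 u (val e)) ue (cardsD1 v (val e :\ u)).
  rewrite !in_setD1 (eq_sym v u) uv ve /= addnA addKn; apply: eq_card => w.
  rewrite inE !inl_subdiv_edge !inE ue ve !andbT.
  by rewrite andbC (eq_sym u) (eq_sym v) (andbC (w != u)) -andbA.
apply/eqP; rewrite mul0n cards_eq0; apply/eqP/setP=> w.
rewrite inE !inl_subdiv_edge !inE.
by apply: contraNF uve => /and3P[_ /andP[_ ->] /andP[_ ->]].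
Qed.

(** The removed vertex may be any vertex of [e] but [u]. The factor [k - 1] cancels the
    normalisation of [adjmx], leaving plain 0-1 incidence blocks. *)
Lemma codegree_subdivision_lr u e :
  codegree (inl u : vertex (subdivision H)) (inr e) =
  ((u \in val e) * (k - 1))%N.
Proof.
rewrite codegree_subdivision (bigD1 e) //= [X in (_ + X)%N]big1 => [|f fe].
  rewrite addn0; have [ue|ue] := boolP (u \in _).
    rewrite mul1n -(Hk (valP e)) (cardsD1 u (val e)) ue addKn.
    apply: eq_card => w; rewrite inE inl_subdiv_edge inr_subdiv_edge !inE.
    by rewrite ue eqxx !andbT andbC (eq_sym u).
  apply/eqP; rewrite mul0n cards_eq0; apply/eqP/setP=> w.
  by rewrite inE inl_subdiv_edge (negbTE ue) !andbF in_set0.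
apply/eqP; rewrite cards_eq0; apply/eqP/setP=> w.
by rewrite inE inr_subdiv_edge in_set0 eq_sym (negbTE fe) !andbF.
Qed.

Lemma codegree_subdivision_rr e f : e != f ->
  codegree (inr e : vertex (subdivision H)) (inr f) = 0%N.
Proof.
move=> ef; rewrite codegree_subdivision big1 // => g _.
apply/eqP; rewrite cards_eq0; apply/eqP/setP=> w.
rewrite inE !inr_subdiv_edge in_set0.
by apply: contraNF ef => /and3P[_ /eqP-> /eqP ->].
Qed.

End SubdivisionCodegree.

Section PowerCodegree.

Variables (k : nat) (G : hypergraph).
Implicit Types (e f : edge_of G) (u v : vertex G) (j : 'I_(k - 2)).

Lemma inl_power_edge e v : (inl v \in power_edge k e) = (v \in val e).
Proof.
rewrite inE orbC; case: imsetP => [[]|_] //=.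
by rewrite mem_imset // => ? ? [].
Qed.

Lemma inr_power_edge e f j : (inr (f, j) \in power_edge k e) = (f == e).
Proof.
rewrite inE; case: imsetP => [[]|_] //=.
by apply/imsetP/eqP => [[i _ [->]]|->] //; exists j.
Qed.

Lemma power_edge_inj : injective (@power_edge k G).
Proof.
move=> e f ef; apply/val_inj/setP=> v.
by rewrite -!inl_power_edge ef.
Qed.

Lemma power_edgeP e : power_edge k e \in hedges (graph_power k G).
Proof. exact: imset_f. Qed.

Definition power_edge_of e : edge_of (graph_power k G) :=
  exist (fun E => E \in hedges (graph_power k G)) _ (power_edgeP e).

Lemma power_edge_of_inj : injective power_edge_of.
Proof. by move=> e f /(congr1 val)/power_edge_inj. Qed.

Lemma card_edge_of (H : hypergraph) : #|edge_of H| = #|hedges H|.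
Proof. exact: card_sig. Qed.

Lemma card_power_edge_of : #|edge_of (graph_power k G)| = #|edge_of G|.
Proof. by rewrite card_edge_of card_imset //; apply: power_edge_inj. Qed.

(** [power_edge_of] is injective between types of equal cardinality, so sums over hyperedges of the
    power can be reindexed by edges of [G]. *)
Lemma codegree_power (x y : vertex (graph_power k G)) :
  codegree x y =
  (\sum_(e : edge_of G) ((x \in power_edge k e) && (y \in power_edge k e)))%N.
Proof.
rewrite codegree_sum (reindex power_edge_of) //=; apply: onW_bij.
by apply: inj_card_bij power_edge_of_inj _; rewrite card_power_edge_of.
Qed.

Lemma codegree_power_ll u v :
  codegree (inl u : vertex (graph_power k G)) (inl v) = codegree u v.
Proof.
by rewrite codegree_power codegree_sum; under eq_bigr do rewrite !inl_power_edge.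
Qed.

Lemma codegree_power_lr u e j :
  codegree (inl u : vertex (graph_power k G)) (inr (e, j)) = (u \in val e).
Proof.
rewrite codegree_power (bigD1 e) //= big1 => [|f fe].
  by rewrite inl_power_edge inr_power_edge eqxx andbT addn0.
by rewrite inr_power_edge eq_sym (negbTE fe) andbF.
Qed.

Lemma codegree_power_rr e f i j :
  codegree (inr (e, i) : vertex (graph_power k G)) (inr (f, j)) = (e == f).
Proof.
rewrite codegree_power (bigD1 e) //= big1 => [|g ge].
  by rewrite !inr_power_edge eqxx addn0 eq_sym.
by rewrite inr_power_edge eq_sym (negbTE ge).
Qed.

End PowerCodegree.

(** * The adjacency matrix in block form *)

(** Here [f] is a permutation, so the two matrices are conjugate. The sizes are kept as separate
    variables because the sum of the block sizes equals the number of vertices only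
    propositionally. *)
Lemma char_poly_mxsub (R : comNzRingType) m n (f : 'I_m -> 'I_n) (A : 'M[R]_n) :
  m = n -> injective f -> char_poly (mxsub f f A) = char_poly A.
Proof.
move=> mn; subst m => finj.
have -> : mxsub f f A = row_perm (perm finj) (col_perm (perm finj) A).
  by apply/matrixP=> i j; rewrite !mxE !permE.
rewrite /char_poly; set s := perm finj.
have -> : char_poly_mx (row_perm s (col_perm s A))
        = row_perm s (col_perm s (char_poly_mx A)).
  by apply/matrixP=> i j; rewrite !mxE (inj_eq perm_inj).
(* The sign of the permutation occurs once for rows and once for columns, and squares to 1. *)
rewrite row_permE col_permE !det_mulmx !det_perm.
by rewrite odd_permV mulrCA -signr_addb addbb mulr1.
Qed.

Section Incidence.

Variables (R : fieldType) (k r : nat) (G : hypergraph).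
Hypothesis k2 : (2 <= k)%N.

Local Notation V := (vertex G).
Local Notation E := (edge_of G).
Local Notation EI := (E * 'I_(k - 2))%type.

Definition incidence_mx : 'M[R]_(#|V|, #|E|) :=
  \matrix_(i < #|V|, j < #|E|) (enum_val i \in val (enum_val j : E))%:R.

Definition fiber_mx : 'M[R]_(#|E|, #|{: EI}|) :=
  \matrix_(i < #|E|, j < #|{: EI}|) (enum_val i == (enum_val j : EI).1)%:R.

(** Both sides record codegrees in [G]; regularity supplies the diagonal, which [adjmx] sets to
    zero. *)
Lemma incidence_gram : regular r G ->
  incidence_mx *m incidence_mx^T = adjmx R 2 G + r%:R%:M.
Proof.
move=> hr; apply/matrixP=> i j; rewrite !mxE.
transitivity ((codegree (enum_val i) (enum_val j))%:R : R).
  rewrite codegree_sum natr_sum (reindex (@enum_val E predT)) /=; last first.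
    exact/onW_bij/enum_val_bij.
  by apply: eq_bigr => e _; rewrite !mxE -natrM mulnb.
case: eqVneq => [->|_]; first by rewrite -hdegreeE hr add0r mulr1n.
by rewrite addr0 (_ : 2%:R - 1 = 1) ?divr1 // addrK.
Qed.

Lemma fiber_gram : fiber_mx *m fiber_mx^T = (k - 2)%:R%:M.
Proof.
apply/matrixP=> i j; rewrite !mxE.
transitivity (\sum_(f : EI) ((enum_val i == f.1) && (enum_val j == f.1))%:R : R).
  rewrite (reindex (@enum_val EI predT)) /=; last exact/onW_bij/enum_val_bij.
  by apply: eq_bigr => e _; rewrite !mxE -natrM mulnb.
rewrite -natr_sum -[RHS]mulr_natr -natrM; congr _%:R.
rewrite -(pair_big predT predT (fun e l =>
  nat_of_bool ((enum_val i == e) && (enum_val j == e)))) /=.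
rewrite (bigD1 (enum_val i)) //= [X in (_ + X)%N]big1 => [|e ne]; last first.
  by rewrite eq_sym (negbTE ne) big1.
by rewrite eqxx (inj_eq enum_val_inj) sum_nat_const card_ord addn0 eq_sym.
Qed.

Lemma incidence_fiberE i j : (incidence_mx *m fiber_mx) i j =
  (enum_val i \in val (enum_val j).1)%:R.
Proof.
rewrite mxE (bigD1 (enum_rank (enum_val j).1)) //= big1 => [|e ne].
  by rewrite !mxE enum_rankK eqxx mulr1 addr0.
rewrite !mxE -(inj_eq enum_rank_inj) enum_valK (negbTE ne).
by rewrite mulr0.
Qed.

Lemma fiber_cogramE i j : (fiber_mx^T *m fiber_mx) i j =
  ((enum_val i).1 == (enum_val j).1)%:R.
Proof.
rewrite mxE (bigD1 (enum_rank (enum_val j).1)) //= big1 => [|e ne].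
  by rewrite !mxE enum_rankK eqxx mulr1 addr0 eq_sym.
rewrite !mxE -[in X in _ * X](inj_eq enum_rank_inj) enum_valK (negbTE ne).
by rewrite mulr0.
Qed.

Local Notation SGk := (subdivision (graph_power k G)).

(** This fixes the order of the blocks: vertices of [G], then points p_e, then extra vertices. The
    type of [SGk] itself groups the first and third kinds together. *)
Definition subdivision_vertex (i : 'I_(#|V| + #|E| + #|{: EI}|)) : vertex SGk :=
  match split i with
  | inl i' => match split i' with
              | inl v => inl (inl (enum_val v))
              | inr e => inr (power_edge_of k (enum_val e))
              end
  | inr f => inl (inr (enum_val f))
  end.

Lemma subdivision_vertex_V i :
  subdivision_vertex (lshift _ (lshift _ i)) = inl (inl (enum_val i)).
Proof. by rewrite /subdivision_vertex !(unsplitK (inl _)). Qed.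

Lemma subdivision_vertex_E i :
  subdivision_vertex (lshift _ (rshift _ i)) = inr (power_edge_of k (enum_val i)).
Proof.
by rewrite /subdivision_vertex (unsplitK (inl _)) (unsplitK (inr _)).
Qed.

Lemma subdivision_vertex_EI i :
  subdivision_vertex (rshift _ i) = inl (inr (enum_val i)).
Proof. by rewrite /subdivision_vertex (unsplitK (inr _)). Qed.

Definition subdivision_vertexE :=
  (subdivision_vertex_V, subdivision_vertex_E, subdivision_vertex_EI).

Lemma subdivision_vertex_inj : injective subdivision_vertex.
Proof.
move=> i j; case: (split_ordP i) => {}i ->; case: (split_ordP j) => {}j ->.
- case: (split_ordP i) => {}i ->; case: (split_ordP j) => {}j ->;
    rewrite !subdivision_vertexE //.
    by move=> [/enum_val_inj->].
  (* Projecting to the underlying hyperedge avoids the membership proof; [set0] is only a filler for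
     the other constructor. *)
  by move=> /(congr1 (fun x => if x is inr e then val e else set0))
    /power_edge_inj/enum_val_inj->.
- by case: (split_ordP i) => {}i ->; rewrite !subdivision_vertexE.
- by case: (split_ordP j) => {}j ->; rewrite !subdivision_vertexE.
- by rewrite !subdivision_vertexE => -[/enum_val_inj->].
Qed.

Lemma card_subdivision_power :
  (#|V| + #|E| + #|{: EI}|)%N = #|vertex SGk|.
Proof. by rewrite !card_sum card_power_edge_of addnAC. Qed.

Hypotheses (G2 : uniform 2 G) (k10 : k%:R - 1 != 0 :> R).

(** Codegrees between vertices of the power carry the factor [k - 2], hence the coefficient
    [(k - 2) / (k - 1)]; those between such a vertex and a point p_e carry [k - 1], hence the
    coefficient 1. *)
Lemma adjmx_subdivision_power :
  let h i := enum_rank (subdivision_vertex i) in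
  mxsub h h (adjmx R k SGk) =
  power_subdivision_mx (adjmx R 2 G) incidence_mx fiber_mx
    ((k%:R - 2) / (k%:R - 1)).
Proof.
move=> h; have Hk := graph_power_uniform k2 G2.
have kB2 : (k - 2)%:R = k%:R - 2 :> R by rewrite natrB.
have kB1 : (k - 1)%:R = k%:R - 1 :> R by rewrite natrB // ltnW.
have one : 2%:R - 1 = 1 :> R by rewrite addrK.
apply/matrixP=> i j; rewrite [LHS]mxE [LHS]mxE /h !enum_rankK.
rewrite (inj_eq enum_rank_inj) (inj_eq subdivision_vertex_inj).
case: (split_ordP i) => {}i ->; case: (split_ordP j) => {}j ->.
- rewrite block_mxEul (inj_eq (@lshift_inj _ _)).
  case: (split_ordP i) => {}i ->; case: (split_ordP j) => {}j ->;
    rewrite !subdivision_vertexE.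
  + rewrite block_mxEul (inj_eq (@lshift_inj _ _)) !mxE.
    case: eqVneq => [|ij]; first by rewrite mulr0.
    rewrite (codegree_subdivision_ll Hk) ?codegree_power_ll; last first.
      by apply: contraNneq ij => -[/enum_val_inj->].
    by rewrite natrM kB2 one divr1 -mulrA mulrC.
  + rewrite block_mxEur eq_lrshift !mxE.
    rewrite (codegree_subdivision_lr Hk) inl_power_edge natrM kB1.
    by rewrite mulfK.
  + rewrite block_mxEdl eq_rlshift !mxE codegreeC.
    rewrite (codegree_subdivision_lr Hk) inl_power_edge natrM kB1.
    by rewrite mulfK.
  + rewrite block_mxEdr (inj_eq (@rshift_inj _ _)) !mxE.
    case: eqVneq => [//|ij].
    rewrite codegree_subdivision_rr ?mul0r //.
    by apply: contraNneq ij => /power_edge_of_inj/enum_val_inj->.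
- rewrite block_mxEur eq_lrshift subdivision_vertexE.
  case: (split_ordP i) => {}i ->; rewrite !subdivision_vertexE.
  + rewrite col_mxEu mxE incidence_fiberE (codegree_subdivision_ll Hk) //.
    case: (enum_val j) => e l; rewrite codegree_power_lr natrM kB2.
    by rewrite -mulrA mulrC.
  + rewrite col_mxEd mxE codegreeC (codegree_subdivision_lr Hk).
    case: (enum_val j) => e l /=; rewrite inr_power_edge natrM kB1 mulfK //.
    by rewrite eq_sym.
- rewrite block_mxEdl eq_rlshift subdivision_vertexE.
  case: (split_ordP j) => {}j ->; rewrite !subdivision_vertexE codegreeC.
  + rewrite row_mxEl 2!mxE incidence_fiberE (codegree_subdivision_ll Hk) //.
    case: (enum_val i) => e l; rewrite codegree_power_lr natrM kB2.
    by rewrite -mulrA mulrC.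
  + rewrite row_mxEr 2!mxE codegreeC (codegree_subdivision_lr Hk).
    case: (enum_val i) => e l /=; rewrite inr_power_edge natrM kB1 mulfK //.
    by rewrite eq_sym.
- rewrite block_mxEdr (inj_eq (@rshift_inj _ _)) !subdivision_vertexE.
  rewrite [RHS]mxE [X in _ = X + _]mxE fiber_cogramE.
  rewrite [X in _ = _ + X]mxE [X in _ = _ - X]mxE; case: eqVneq => [->|ij].
    (* The diagonal of [U^T U] is 1, and the subtracted scalar matrix brings the entry back to
       zero. *)
    by rewrite eqxx mulr1 subrr.
  rewrite (codegree_subdivision_ll Hk); last first.
    by apply: contraNneq ij => -[/enum_val_inj->].
  case: (enum_val i) (enum_val j) => e l [f l'].
  by rewrite codegree_power_rr natrM kB2 subr0 -mulrA mulrC.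
Qed.

End Incidence.

(** * The characteristic polynomial *)

Lemma mup_prod (R : fieldType) (I : Type) (s : seq I) (P : I -> {poly R}) x :
  \prod_(i <- s) P i != 0 ->
  mup x (\prod_(i <- s) P i) = (\sum_(i <- s) mup x (P i))%N.
Proof.
elim: s => [|i s IHs]; rewrite ?big_nil ?big_cons.
  by move=> _; rewrite mupNroot // root1.
by rewrite mulf_eq0 negb_or => /andP[Pi /[dup] Ps /IHs <-]; rewrite mupM.
Qed.

Lemma mup_exp (R : fieldType) (p : {poly R}) n x :
  p != 0 -> mup x (p ^+ n) = (n * mup x p)%N.
Proof.
move=> p0; elim: n => [|n IHn]; first by rewrite mupNroot // root1.
by rewrite exprS mupM ?expf_neq0 // IHn mulSn.
Qed.

Lemma mup_scale (R : fieldType) (p : {poly R}) c x :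
  c != 0 -> mup x (c *: p) = mup x p.
Proof. by move=> c0; rewrite -mul_polyC mupMr ?rootC. Qed.

Lemma mup_prod_XsubC (R : fieldType) (s : seq R) x :
  mup x (\prod_(z <- s) ('X - z%:P)) = count_mem x s.
Proof.
rewrite mup_prod ?monic_neq0 ?monic_prod_XsubC //.
elim: s => [|z s IHs]; rewrite ?big_nil ?big_cons //= IHs.
by rewrite -['X - _]expr1 mup_XsubCX; case: eqP.
Qed.

(** * Passage to the field of rational functions *)

Lemma map_power_subdivision_mx (R F : fieldType) (f : {rmorphism R -> F}) n m N
    (A : 'M[R]_n) (B : 'M[R]_(n, m)) (U : 'M[R]_(m, N)) a :
  map_mx f (power_subdivision_mx A B U a) =
  power_subdivision_mx (map_mx f A) (map_mx f B) (map_mx f U) (f a).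
Proof.
rewrite /power_subdivision_mx !map_block_mx map_col_mx map_row_mx.
by rewrite !map_mxB !map_mxZ !trmx_mul !map_mxM !map_trmx map_scalar_mx map_mx0.
Qed.

(** This is the factor of the final pencil at an eigenvalue [l]. With [w] cancelled, only the
    denominator [q] is left; over all eigenvalues it yields the exponent [-n]. *)
Lemma pencil_factorE (F : fieldType) (x a r l w q g : F) : w != 0 -> q != 0 ->
  x - r * (w * g) / (w * q) - (a + w * g / (w * q)) * l =
  ((x - a * l) * q - (r + l) * g) / q.
Proof. by move=> w0 q0; field; rewrite w0 q0. Qed.

(** The composite is named so that it can carry the ring morphism structure that [det_pencil]
    expects. *)
Definition const_frac (R : fieldType) : R -> {fraction {poly R}} :=
  @FracField.tofrac {poly R} \o polyC.

HB.instance Definition _ (R : fieldType) :=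
  GRing.RMorphism.on (@const_frac R).

Lemma char_poly_frac (R : fieldType) n (A : 'M[R]_n) :
  (char_poly A)%:F = \det ('X%:F%:M - map_mx (@const_frac R) A).
Proof.
rewrite -det_map_mx; congr (\det _).
by rewrite /char_poly_mx map_mxB map_scalar_mx -map_mx_comp.
Qed.

(** Since [m - n] is negative for small [r], the exponent of [q] is an integer and the factorisation
    is stated for rational functions. The second conjunct reads off multiplicities, again as
    integers. *)
Theorem theorem2 (R : rcfType) (k r n m : nat) (G : hypergraph)
    (lambda : n.-tuple R)
    (hk : (3 <= k)%N) (hG : uniform 2 G) (hr : regular r G)
    (hn : #|vertex G| = n) (hm : #|hedges G| = m)
    (hlambda : is_spectrum (adjmx R 2 G) lambda) :
  let K : R := k%:R in
  let a : R := (K - 2) / (K - 1) in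
  let A := adjmx R k (subdivision (graph_power k G)) in
  let q : {poly R} := 'X^2 - ((K - 2) * (K - 3) / (K - 1)) *: 'X - (K - 2)%:P in
  let c (i : 'I_n) : {poly R} :=
    ((K - 1) ^+ 2)^-1 *: cubic_poly k r (tnth lambda i) in
  (char_poly A)%:F
    = ('X + a%:P)%:F ^+ (m * (k - 3)) * q%:F ^ (m%:Z - n%:Z)
      * \prod_(i < n) (c i)%:F
  /\
  (forall mu : seq R, is_spectrum A mu ->
    forall x : R,
      (count_mem x mu)%:Z
      = (if x == - a then (m * (k - 3))%N%:Z else 0)
        + (m%:Z - n%:Z) * (mup x (quad_poly R k))%:Z
        + \sum_(i < n) (mup x (cubic_poly k r (tnth lambda i)))%:Z).
Proof.
move=> K a A q c; subst n.
have K1 : K - 1 != 0 by rewrite subr_eq0 /K pnatr_eq1; lia.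
(* The block determinant is applied with [p = K - 2] and [x] the indeterminate. Its side conditions
   then only ask for nonzero polynomials, so no value of [x] is excluded. *)
pose w : {poly R} := 'X - (a * (K - 3))%:P.
have y0 : 'X + a%:P != 0.
  by rewrite -[a]opprK polyCN polyXsubC_eq0.
have w0 : w != 0 by rewrite polyXsubC_eq0.
have qE : q = 'X * w - (K - 2)%:P.
  rewrite /q /w ['X * _]mulrBr -expr2 ['X * _%:P]mulrC mul_polyC.
  congr (_ - _ *: _ - _).
  by rewrite /a mulrAC.
have q0 : q != 0.
  apply/eqP => /(congr1 (fun p : {poly R} => p`_2))/eqP.
  by rewrite !coefE /= !mulr0 !subr0 oner_eq0.
(* The multiplier of (A + rI) in the final Schur complement is g / q. *)
pose g : {poly R} :=
  (a ^+ 2 * (K - 2) + 1)%:P * 'X + (2 * a * (K - 2) - a * (K - 3))%:P.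
(* Divisibility by [w] is visible modulo [w], with [p = K - 2]: [q] becomes [-p] and ['X + a]
   becomes [a p], so the left side becomes [-a^2 p^2 + a^2 p^2]. *)
have gE : a%:P ^+ 2 * (K - 2)%:P * q + ('X + a%:P) ^+ 2 = w * g.
  by rewrite qE /w /g; ring.
have cE i : c i = ('X - (a * tnth lambda i)%:P) * q
                  - (r%:R + tnth lambda i)%:P * g.
  set l := tnth lambda i; rewrite /c /cubic_poly -/K -/l.
  (* The monic form in [a] separates the divisions by [K - 1], settled coefficientwise by [field],
     from the polynomial identity left to [ring]. *)
  transitivity ('X^3 - (a * (l + K - 3))%:P * 'X^2
    - (r%:R + l + (K - 2) + a ^+ 2 * (K - 2) * (r%:R + l)
       - a ^+ 2 * (K - 3) * l)%:P * 'X
    + (a * (K - 3) * (r%:R + l) + a * (K - 2) * l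
       - 2 * a * (K - 2) * (r%:R + l))%:P).
    rewrite scalerDr !scalerBr !scalerA mulVf ?expf_neq0 // scale1r !mul_polyC.
    rewrite -[_ *: _%:P]mul_polyC -polyCM.
    by congr (_ - _ *: _ - _ *: _ + _%:P); rewrite /a; field.
  by rewrite qE /w /g; ring.
have key : (char_poly A)%:F =
    ('X + a%:P)%:F ^+ (m * (k - 3)) * q%:F ^ (m%:Z - #|vertex G|%:Z) *
    \prod_(i < #|vertex G|) (c i)%:F.
  pose f := @const_frac R.
  have yF : 'X%:F + f a = ('X + a%:P)%:F by rewrite rmorphD.
  have wF : 'X%:F - f a * (f (K - 2) - 1) = w%:F.
    have -> : w = 'X - a%:P * ((K - 2)%:P - 1).
      by rewrite /w -polyC1 -polyCB -polyCM; congr (_ - (_ * _)%:P); ring.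
    by rewrite rmorphB rmorphM rmorphB rmorph1.
  have qF : 'X%:F * w%:F - f (K - 2) = q%:F by rewrite qE [RHS]tofracB tofracM.
  have cardE := card_subdivision_power k G.
  have k2 : (2 <= k)%N by exact: ltnW.
  pose h i := enum_rank (@subdivision_vertex k G i).
  have hI : injective h by move=> i j /enum_rank_inj/subdivision_vertex_inj.
  rewrite -(char_poly_mxsub A cardE hI).
  rewrite adjmx_subdivision_power // char_poly_frac map_power_subdivision_mx.
  have BB := congr1 (map_mx f) (incidence_gram R hr).
  have UU := congr1 (map_mx f) (fiber_gram R k G).
  rewrite map_mxM -map_trmx map_mxD map_scalar_mx in BB.
  rewrite map_mxM -map_trmx map_scalar_mx natrB // in UU.
  have := @det_power_subdivision_mx _ _ _ _ _ _ _ 'X%:F (f a) _ _ BB UU.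
  rewrite yF wF qF !tofrac_eq0 (det_pencil _ _ _ hlambda).
  move=> /(_ y0 w0 q0).
  rewrite [X in _ = _ * X](eq_bigr (fun i => (c i)%:F / q%:F)) => [|i _];
    last first.
    have gF : f a ^+ 2 * f (K - 2) * q%:F + ('X + a%:P)%:F ^+ 2 = w%:F * g%:F.
      by rewrite -tofracM -gE [RHS]tofracD 2!tofracM !tofracXn.
    set l := tnth lambda i.
    have cF : (c i)%:F = ('X%:F - f a * f l) * q%:F - (f r%:R + f l) * g%:F.
      by rewrite cE /f /const_frac /=; ring.
    by rewrite gF cF -(@pencil_factorE _ _ _ _ _ w%:F) ?tofrac_eq0.
  move=> detE; apply: (@mulIf _ (('X + a%:P)%:F ^+ #|edge_of G|)).
    by rewrite expf_neq0 ?tofrac_eq0.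
  apply: etrans detE _.
  rewrite big_split /= prodfV prodr_const card_prod !card_ord card_edge_of hm.
  (* The surplus [m] cancels the factor [('X + a) ^+ m] introduced above. Subtraction is truncated,
     so [hk] is needed here. *)
  rewrite (_ : (m * (k - 2) = m * (k - 3) + m)%N); last by nia.
  rewrite exprD expfzDr ?tofrac_eq0 // -exprnP -exprnN.
  rewrite -!mulrA; congr (_ * _); rewrite mulrC -!mulrA; congr (_ * _).
  exact: mulrCA.
split=> // mu muA x.
(* Multiplying by [q ^+ n] removes the possibly negative exponent and returns to polynomials, where
   [mup] makes sense. *)
have keyP : char_poly A * q ^+ #|vertex G| =
    ('X + a%:P) ^+ (m * (k - 3)) * q ^+ m * \prod_(i < #|vertex G|) c i.
  apply/eqP; rewrite -tofrac_eq; apply/eqP.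
  rewrite [LHS]tofracM [RHS]tofracM [X in _ = X * _]tofracM !tofracXn key.
  rewrite expfzDr ?tofrac_eq0 // -exprnP -exprnN rmorph_prod /=.
  by rewrite mulrAC mulrA mulfVK ?expf_neq0 ?tofrac_eq0.
have nz : char_poly A * q ^+ #|vertex G| != 0.
  by rewrite mulf_neq0 ?expf_neq0 // monic_neq0 ?char_poly_monic.
have := congr1 (fun p => (mup x p)%:Z) keyP.
rewrite mupM ?expf_neq0 ?(monic_neq0 (char_poly_monic _)) // muA mup_prod_XsubC.
(* That the product of the cubics is nonzero is inherited from the left side, whose characteristic
   polynomial is monic. *)
rewrite keyP in nz; move: nz; rewrite mulf_eq0 negb_or => /andP[ncc nc].
rewrite mupM // mupM ?expf_neq0 // mup_prod // !mup_exp //.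
have -> : quad_poly R k = (K - 1) *: q.
  rewrite /quad_poly -/K /q !scalerBr scalerA -[_ *: _%:P]mul_polyC -polyCM.
  by congr (_ - _ *: _ - _); field.
have -> : mup x ('X + a%:P) = (x == - a).
  by rewrite -[a]opprK polyCN -['X - _]expr1 mup_XsubCX opprK eq_sym; case: eqP.
under eq_bigr do rewrite mup_scale ?invr_eq0 ?expf_neq0 //.
rewrite mup_scale // -(big_morph Posz PoszD (erefl _)) => E.
apply: (@addIr _ (#|vertex G|%:Z * (mup x q)%:Z)).
rewrite -[X in _ + X]PoszM -PoszD E !PoszD !PoszM.
move: (Posz (k - 3)) (Posz (\sum_i _)) (Posz (mup x q)) => t s u.
by case: (x == - a); rewrite ?mulr1 ?mulr0; ring.
Qed.
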